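(* For a ring $R$ the following conditions are equivalent: (1) $G(R)$ is triangle-free; (2) $R$ is one of the following independent types: (i) either $R$ is a division ring, or $R$ contains precisely one nontrivial left ideal (equal to the prime radical $\beta(R)$), or $R$ contains precisely two nontrivial left ideals $\beta(R)$, $(\beta(R))^2$. Moreover, the graph $G(R)$ is equal to $\mathcal N_0$, $\mathcal K_1$ and $\mathcal K_2$, respectively; (ii) $R$ is isomorphic either to $M_2(\Delta)$ or to $\Delta\oplus\Delta$, where $\Delta$ is a division ring. In the former case $G(R)=\mathcal N_{|\Delta|+1}$ and in the latter $G(R)=\mathcal N_2$; (iii) $R/\beta(R)=\Delta$ is a division ring, $(\beta(R))^2=0$ and $\beta(R)=S_1\oplus S_2$, where $S_1,S_2$ are minimal left ideals both isomorphic to $\Delta$ as left $R$-modules (and also as $\Delta$-modules). In this case $G(R)=\mathcal S_{|\Delta|+2}$.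
   Context: Rings are associative with unity. A left ideal of $R$ is nontrivial if it is different from $0$ and $R$. The intersection graph $G(R)$ is the simple graph whose vertices are the nontrivial left ideals of $R$, two distinct vertices being adjacent iff their intersection is nonzero. A graph is triangle-free if it has no three distinct pairwise adjacent vertices. $\beta(R)$ denotes the prime radical of $R$ (the intersection of all prime ideals), and $M_2(\Delta)$ is the ring of $2\times 2$ matrices over $\Delta$. Equality of graphs means isomorphism. For a cardinal $\alpha$: $\mathcal K_\alpha$ is the complete graph on $\alpha$ vertices; $\mathcal N_\alpha$ is the null graph (no edges) on $\alpha$ vertices ($\mathcal N_0$ being the graph with no vertices); $\mathcal S_\alpha$ is the star graph on $\alpha$ vertices, i.e. one vertex is adjacent to all the others and no two of the others are adjacent.
   Formalization: In (ii), Δ⊕Δ is replaced by Δ₁⊕Δ₂ with Δ₁, Δ₂ possibly non-isomorphic division rings, since Z/6Z = F₂⊕F₃ has triangle-free G(R) but is of none of the types as literally stated; R is taken to be nonzero. *)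

(* Defs.v *)
From HB Require Import structures.
From mathcomp Require Import all_boot all_algebra.
From mathcomp Require Import boolp classical_sets functions.

Set Implicit Arguments.
Unset Strict Implicit.
Unset Printing Implicit Defensive.

Import GRing.Theory.
Local Open Scope classical_set_scope.
Local Open Scope ring_scope.

Record simple_graph := SimpleGraph {
  vertex : Type;
  adj : vertex -> vertex -> Prop;
  adj_irrefl : forall x, ~ adj x x;
  adj_sym : forall x y, adj x y -> adj y x }.

Definition triangle_free (G : simple_graph) : Prop :=
  ~ exists x y z : vertex G,
      [/\ x <> y, y <> z & x <> z] /\ [/\ adj x y, adj y z & adj x z].

Definition graph_iso (G H : simple_graph) : Prop :=
  exists2 f : vertex G -> vertex H,
    bijective f & forall x y, adj x y <-> adj (f x) (f y).

(* The standard graphs take a vertex type [V] in place of its cardinal. *)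
Lemma null_irrefl (V : Type) (x : V) : ~ False.
Proof. by []. Qed.
Lemma null_sym (V : Type) (x y : V) : False -> False.
Proof. by []. Qed.
Definition null_graph (V : Type) : simple_graph :=
  @SimpleGraph V (fun _ _ => False) (@null_irrefl V) (@null_sym V).

Lemma complete_irrefl (V : Type) (x : V) : ~ (x <> x).
Proof. by move=> h; apply: h. Qed.
Lemma complete_sym (V : Type) (x y : V) : x <> y -> y <> x.
Proof. by move=> h e; apply: h. Qed.
Definition complete_graph (V : Type) : simple_graph :=
  @SimpleGraph V (fun x y => x <> y) (@complete_irrefl V) (@complete_sym V).

Lemma star_irrefl (V : Type) (c x : V) : ~ (x <> x /\ (x = c \/ x = c)).
Proof. by case=> h _; apply: h. Qed.
Lemma star_sym (V : Type) (c x y : V) :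
  x <> y /\ (x = c \/ y = c) -> y <> x /\ (y = c \/ x = c).
Proof. by case=> h k; split; [move=> e; apply: h | case: k; [right | left]]. Qed.
Definition star_graph (V : Type) (c : V) : simple_graph :=
  @SimpleGraph V (fun x y => x <> y /\ (x = c \/ y = c))
    (@star_irrefl V c) (@star_sym V c).

Section Ideals.
Variable R : nzRingType.
Implicit Types I J P S T : set R.

Definition left_ideal I : Prop :=
  [/\ I 0, (forall x y, I x -> I y -> I (x + y))
    & (forall r x, I x -> I (r * x))].

Definition ideal I : Prop :=
  left_ideal I /\ (forall r x, I x -> I (x * r)).

Definition nontrivial_left_ideal I : Prop :=
  [/\ left_ideal I, I <> [set 0] & I <> setT].

Definition minimal_left_ideal S : Prop :=
  [/\ left_ideal S, S <> [set 0]
    & forall I, left_ideal I -> I `<=` S -> I = [set 0] \/ I = S].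

Definition ideal_mul I J : set R :=
  [set x | exists n (a b : 'I_n -> R),
     [/\ forall i, I (a i), forall i, J (b i) & x = \sum_(i < n) a i * b i]].

Definition prime_ideal P : Prop :=
  [/\ ideal P, P <> setT
    & forall I J, ideal I -> ideal J ->
        ideal_mul I J `<=` P -> I `<=` P \/ J `<=` P].

Definition prime_radical : set R := \bigcap_(P in prime_ideal) P.

(* Internal direct sum of left ideals. *)
Definition is_direct_sum T S1 S2 : Prop :=
  T = [set x | exists s1 s2, [/\ S1 s1, S2 s2 & x = s1 + s2]]
  /\ S1 `&` S2 = [set 0].

Definition division_ring : Prop :=
  forall x : R, x != 0 -> exists y : R, y * x = 1 /\ x * y = 1.

End Ideals.
Arguments prime_radical R : clear implicits.
Arguments division_ring R : clear implicits.

Section IntersectionGraph.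
Variable R : nzRingType.

Definition ig_vertex : Type := {I : set R | nontrivial_left_ideal I}.

Definition ig_adj (I J : ig_vertex) : Prop :=
  I <> J /\ sval I `&` sval J <> [set 0].

Lemma ig_irrefl I : ~ ig_adj I I.
Proof. by case=> h _; apply: h. Qed.
Lemma ig_sym I J : ig_adj I J -> ig_adj J I.
Proof. by case=> h k; split; [move=> e; apply: h | rewrite setIC]. Qed.

Definition intersection_graph : simple_graph := SimpleGraph ig_irrefl ig_sym.

End IntersectionGraph.
Arguments intersection_graph R : clear implicits.

Definition ring_isomorphic (R S : nzRingType) : Prop :=
  exists f : {rmorphism R -> S}, bijective f.

(* The additive subgroup [S] of [R], with scalars [A] acting through [actS], is
   isomorphic as an [A]-module to [D], with scalars acting through [actD]. *)
Definition module_isomorphic (A D R : nzRingType) (actD : A -> D -> D)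
    (S : set R) (actS : A -> R -> R) : Prop :=
  exists phi : {additive D -> R},
    [/\ injective phi, range phi = S
      & forall a d, phi (actD a d) = actS a (phi d)].

(* [pi] presents [D] as the quotient ring [R / I]. *)
Definition is_quotient_map (R D : nzRingType) (I : set R)
    (pi : {rmorphism R -> D}) : Prop :=
  range pi = setT /\ [set r | pi r = 0] = I.

(* [S] is isomorphic to [D], a quotient of [R] via [pi], as an [R]-module. *)
Definition isomorphic_over_ring (R D : nzRingType) (pi : {rmorphism R -> D})
    (S : set R) : Prop :=
  module_isomorphic (fun (r : R) (d : D) => pi r * d) S (fun r x => r * x).

(* The same over [D]; the condition on [act] says that the action of [R] on [S]
   factors through [pi], and determines [act] on [S] when [pi] is surjective. *)
Definition isomorphic_over_quotient (R D : nzRingType) (pi : {rmorphism R -> D})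
    (S : set R) : Prop :=
  exists act : D -> R -> R,
    (forall r x, S x -> act (pi r) x = r * x) /\
    module_isomorphic (fun c d : D => c * d) S act.

Section Types.
Variable R : nzRingType.
Local Notation beta := (prime_radical R).

Definition one_nontrivial_left_ideal : Prop :=
  forall I : set R, nontrivial_left_ideal I <-> I = beta.

Definition two_nontrivial_left_ideals : Prop :=
  beta <> ideal_mul beta beta /\
  forall I : set R,
    nontrivial_left_ideal I <-> I = beta \/ I = ideal_mul beta beta.

Definition type_i : Prop :=
  [\/ division_ring R, one_nontrivial_left_ideal | two_nontrivial_left_ideals].

Definition is_matrix_ring_over (D : nzRingType) : Prop :=
  division_ring D /\ ring_isomorphic R 'M[D]_2.

Definition is_sum_of_division_rings (D1 D2 : nzRingType) : Prop :=
  [/\ division_ring D1, division_ring D2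
    & ring_isomorphic R (D1 * D2)%type].

(* The two summands are not required to be isomorphic: Z/6Z = F_2 (+) F_3 has
   exactly two nontrivial left ideals, and they are not adjacent. *)
Definition type_ii : Prop :=
  (exists D, is_matrix_ring_over D) \/
  (exists D1 D2, is_sum_of_division_rings D1 D2).

Definition type_iii_over (D : nzRingType) : Prop :=
  division_ring D /\
  exists2 pi : {rmorphism R -> D}, is_quotient_map beta pi &
    ideal_mul beta beta = [set 0] /\
    exists S1 S2 : set R,
      [/\ is_direct_sum beta S1 S2,
          minimal_left_ideal S1 /\ minimal_left_ideal S2,
          isomorphic_over_ring pi S1 /\ isomorphic_over_ring pi S2
        & isomorphic_over_quotient pi S1 /\ isomorphic_over_quotient pi S2].

Definition type_iii : Prop := exists D, type_iii_over D.

End Types.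

(* Main.v *)
(* A chain of three nontrivial left ideals, or two nontrivial left ideals above
   a common one, is a triangle in G(R).  Hence a triangle-free G(R) forces R to
   have length at most 3 as a left module.  If no nontrivial left ideal contains
   another, R is a division ring, or it has a single nontrivial left ideal, or
   it is the direct sum of two minimal left ideals Re and Rf with e + f = 1,
   which gives M_2(eRe) or eRe + fRf according to whether eRf and fRe vanish.
   If A < B is a chain, then B contains every proper left ideal, so R is local
   with radical B, B annihilates the minimal left ideals, and B^2 lies in every
   nontrivial left ideal.  If B^2 <> 0, it is the only nontrivial left ideal
   besides B; if B^2 = 0, then B is a plane over the division ring R/B.
   In the converse direction each type determines G(R): for M_2(D) and for type
   (iii) the vertices other than beta(R) are the lines of the plane D^2, counted
   by their slope in [option D]. *)
Require Import Defs.
From HB Require Import structures.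
From mathcomp Require Import all_boot all_algebra.
From mathcomp Require Import boolp classical_sets functions.
From mathcomp Require Import generic_quotient ring_quotient.

Set Implicit Arguments.
Unset Strict Implicit.
Unset Printing Implicit Defensive.

Import GRing.Theory.
Local Open Scope classical_set_scope.
Local Open Scope ring_scope.

(** * Left ideals *)

Section IdealLemmas.
Variable R : nzRingType.
Implicit Types I J A B : set R.

Lemma left_idealN I x : left_ideal I -> I x -> I (- x).
Proof. by case=> _ _ IM Ix; rewrite -mulN1r; apply: IM. Qed.

Lemma left_idealB I x y : left_ideal I -> I x -> I y -> I (x - y).
Proof. by move=> II Ix Iy; case: (II) => _ ID _; apply: ID => //; apply: left_idealN. Qed.

Lemma left_ideal1 I : left_ideal I -> I 1 -> I = setT.
Proof.
by case=> _ _ IM I1; apply/seteqP; split=> // x _; rewrite -(mulr1 x); apply: IM.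
Qed.

Lemma left_ideal_neq0 I : left_ideal I -> (exists2 x, I x & x != 0) <-> I <> [set 0].
Proof.
move=> [I0 _ _]; split=> [[x Ix /eqP x0] I_0|In0]; first by move: Ix; rewrite I_0.
apply: contrapT => /forall2NP h; apply: In0; apply/seteqP; split=> [x Ix|_ ->//].
by case: (h x) => // /negP; rewrite negbK => /eqP.
Qed.

Lemma left_idealI I J : left_ideal I -> left_ideal J -> left_ideal (I `&` J).
Proof.
move=> [I0 ID IM] [J0 JD JM]; split=> // [x y [? ?] [? ?]|r x [? ?]].
  by split; [apply: ID | apply: JD].
by split; [apply: IM | apply: JM].
Qed.

(** The set that occurs in [is_direct_sum], so that facts about [left_sum] apply there by
    conversion. *)
Definition left_sum I J : set R :=
  [set x | exists s1 s2, [/\ I s1, J s2 & x = s1 + s2]].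

Lemma left_ideal_sum I J : left_ideal I -> left_ideal J -> left_ideal (left_sum I J).
Proof.
move=> [I0 ID IM] [J0 JD JM]; split.
- by exists 0, 0; rewrite addr0.
- move=> _ _ [a [b [Ia Jb ->]]] [c [d [Ic Jd ->]]].
  by exists (a + c), (b + d); rewrite addrACA; split; [apply: ID|apply: JD|].
- move=> r _ [a [b [Ia Jb ->]]]; exists (r * a), (r * b).
  by rewrite mulrDr; split; [apply: IM|apply: JM|].
Qed.

Lemma left_sumSl I J : left_ideal J -> I `<=` left_sum I J.
Proof. by case=> J0 _ _ x Ix; exists x, 0; rewrite addr0. Qed.

Lemma left_sumSr I J : left_ideal I -> J `<=` left_sum I J.
Proof. by case=> I0 _ _ x Jx; exists 0, x; rewrite add0r. Qed.

Definition principal (x : R) : set R := range (fun r => r * x).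

Lemma left_ideal_principal x : left_ideal (principal x).
Proof.
split; first by exists 0; rewrite ?mul0r.
- by move=> _ _ [a _ <-] [b _ <-]; exists (a + b); rewrite ?mulrDl.
- by move=> r _ [a _ <-]; exists (r * a); rewrite ?mulrA.
Qed.

Lemma principal_id x : principal x x.
Proof. by exists 1; rewrite ?mul1r. Qed.

Lemma principal_sub I x : left_ideal I -> I x -> principal x `<=` I.
Proof. by case=> _ _ IM Ix _ [r _ <-]; apply: IM. Qed.

Lemma ideal_mul_left_ideal I J : left_ideal I -> left_ideal (ideal_mul I J).
Proof.
move=> [I0 ID IM]; split.
- by exists 0%N, (fun=> 0), (fun=> 0); split; [case|case|rewrite big_ord0].
- move=> _ _ [n [a [b [Ia Jb ->]]]] [m [c [d [Ic Jd ->]]]].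
  (* Two sums of products are added by concatenating their families. *)
  exists (n + m)%N, (fun k => match fintype.split k with inl i => a i | inr i => c i end),
   (fun k => match fintype.split k with inl i => b i | inr i => d i end).
  split=> [k|k|]; try by case: (fintype.split k).
  rewrite big_split_ord; congr (_ + _); apply: eq_bigr => i _.
    by rewrite (unsplitK (inl i)).
  by rewrite (unsplitK (inr i)).
- move=> r _ [n [a [b [Ia Jb ->]]]]; exists n, (fun i => r * a i), b.
  split=> // [i|]; first exact: IM.
  by rewrite mulr_sumr; apply: eq_bigr => i _; rewrite mulrA.
Qed.

Lemma ideal_mul_mem I J a b : I a -> J b -> ideal_mul I J (a * b).
Proof.
by move=> Ia Jb; exists 1%N, (fun=> a), (fun=> b); split=> //; rewrite big_ord1.
Qed.

Lemma ideal_mul_sub I J A : left_ideal A ->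
  (forall a b, I a -> J b -> A (a * b)) -> ideal_mul I J `<=` A.
Proof.
move=> [A0 AD _] h _ [n [a [b [Ia Jb ->]]]].
by elim/big_ind: _ => // i _; apply: h.
Qed.

Lemma ideal_mul_ideal I J : ideal I -> ideal J -> ideal (ideal_mul I J).
Proof.
move=> [Il _] [_ Jr]; split=> [|r _ [n [a [b [Ia Jb ->]]]]].
  exact: ideal_mul_left_ideal.
exists n, a, (fun i => b i * r); split=> // [i|]; first exact: Jr.
by rewrite mulr_suml; apply: eq_bigr => i _; rewrite mulrA.
Qed.

End IdealLemmas.

(** * Quotient rings and corner rings *)

(** A left inverse [y] of [x] is nonzero, so it has a left inverse [z] in turn, and
    [z = z (y x) = x] makes [y] two-sided. *)
Lemma left_inv_division_ring (D : nzRingType) :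
  (forall x : D, x != 0 -> exists y, y * x = 1) -> division_ring D.
Proof.
move=> h x x0; have [y yx] := h x x0; exists y; split=> //.
have y0 : y != 0 by apply/eqP => y0; move: (oner_neq0 D); rewrite -yx y0 mul0r eqxx.
have [z zy] := h y y0.
by have <- : z = x by rewrite -[z]mulr1 -yx mulrA zy mul1r.
Qed.

Section QuotientRing.
Variables (R : nzRingType) (I : set R).
Hypotheses (idI : ideal I) (I1 : ~ I 1).

Definition quotient_pred : {pred R} := [pred x | `[< I x >]].

Lemma quotient_predP x : reflect (I x) (x \in quotient_pred).
Proof. exact: asboolP. Qed.

Lemma quotient_pred_zmod_closed : zmod_closed quotient_pred.
Proof.
split=> [|x y /quotient_predP Ix /quotient_predP Iy]; apply/quotient_predP.
  by case: idI => [[]].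
by apply: left_idealB => //; case: idI.
Qed.

HB.instance Definition _ :=
  GRing.isZmodClosed.Build R quotient_pred quotient_pred_zmod_closed.

(* The type carries the proof of [~ I 1] so that the ring instance, which needs
   it for [1 != 0], can be inferred. *)
Definition quotient_ring of ~ I 1 := {ideal_quot quotient_pred}.
Local Notation Q := (quotient_ring I1).
HB.instance Definition _ := GRing.Zmodule.on Q.

Local Notation pi := (\pi_({ideal_quot quotient_pred})%qT : R -> Q).

Lemma quotient_piP x y : pi x = pi y <-> I (x - y).
Proof.
split=> [/eqP|/quotient_predP]; rewrite ?Quotient.idealrBE.
  by move=> e; apply/quotient_predP; rewrite Quotient.idealrBE.
by move/eqP.
Qed.

(** Computed on chosen representatives; [quotient_piM] shows that the choice is immaterial. *)
Definition quotient_mul (x y : Q) : Q :=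
  pi (repr (x : {ideal_quot quotient_pred}) * repr (y : {ideal_quot quotient_pred})).

Lemma quotient_ind (P : Q -> Prop) : (forall x, P (pi x)) -> forall x, P x.
Proof. by move=> h x; rewrite -[x](@reprK _ {ideal_quot quotient_pred}). Qed.

Lemma quotient_piD : {morph pi : x y / x + y}.
Proof. exact: (raddfD (\pi_({ideal_quot quotient_pred})%qT)). Qed.

Lemma quotient_piM : {morph pi : x y / x * y >-> quotient_mul x y}.
Proof.
move=> x y; have reprB z : I (z - repr (pi z : {ideal_quot quotient_pred})).
  by apply/quotient_piP; rewrite (@reprK _ {ideal_quot quotient_pred}).
apply/quotient_piP; move: (reprB x) (reprB y).
set x' := repr _; set y' := repr _ => Ix Iy; case: idI => Il Ir.
(* The first term lies in [I] because [I] is a left ideal, the second because it is a right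
   ideal. *)
have -> : x * y - x' * y' = x * (y - y') + (x - x') * y'.
  by rewrite mulrBr mulrBl addrA addrNK.
by case: Il => _ ID IM; apply: ID; [apply: IM|apply: Ir].
Qed.

Lemma quotient_mulA : associative quotient_mul.
Proof.
elim/quotient_ind=> x; elim/quotient_ind=> y; elim/quotient_ind=> z.
by rewrite -!quotient_piM mulrA.
Qed.
Lemma quotient_mul1l : left_id (pi 1) quotient_mul.
Proof. by elim/quotient_ind=> x; rewrite -!quotient_piM mul1r. Qed.
Lemma quotient_mul1r : right_id (pi 1) quotient_mul.
Proof. by elim/quotient_ind=> x; rewrite -!quotient_piM mulr1. Qed.
Lemma quotient_mulDl : left_distributive quotient_mul +%R.
Proof.
elim/quotient_ind=> x; elim/quotient_ind=> y; elim/quotient_ind=> z.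
by rewrite -!(quotient_piM, quotient_piD) mulrDl.
Qed.
Lemma quotient_mulDr : right_distributive quotient_mul +%R.
Proof.
elim/quotient_ind=> x; elim/quotient_ind=> y; elim/quotient_ind=> z.
by rewrite -!(quotient_piM, quotient_piD) mulrDr.
Qed.
Lemma quotient_1neq0 : pi 1 != 0.
Proof.
have -> : 0 = pi 0 by rewrite -[RHS](addrK (pi 0)) -quotient_piD addr0 subrr.
by apply/eqP => /quotient_piP; rewrite subr0.
Qed.

HB.instance Definition _ := GRing.Zmodule_isNzRing.Build Q
  quotient_mulA quotient_mul1l quotient_mul1r quotient_mulDl quotient_mulDr
  quotient_1neq0.

End QuotientRing.

(** For maps defined in the middle of a proof, which have no declared instance. *)
Lemma rmorphism_of (R S : nzRingType) (f : R -> S) :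
  zmod_morphism f -> monoid_morphism f -> exists F : {rmorphism R -> S}, F =1 f.
Proof.
move=> fB fM.
pose F1 := GRing.isZmodMorphism.Build R S f fB.
pose F2 := GRing.isMonoidMorphism.Build R S f fM.
pose F : {rmorphism R -> S} := HB.pack f F1 F2.
by exists F.
Qed.

Lemma additive_of (R S : zmodType) (f : R -> S) :
  zmod_morphism f -> exists F : {additive R -> S}, F =1 f.
Proof.
move=> fB; pose F1 := GRing.isZmodMorphism.Build R S f fB.
pose F : {additive R -> S} := HB.pack f F1.
by exists F.
Qed.

Lemma quotient_ring_exists (R : nzRingType) (I : set R) : ideal I -> ~ I 1 ->
  exists (D : nzRingType) (pi : {rmorphism R -> D}), is_quotient_map I pi.
Proof.
move=> idI I1; pose Q : nzRingType := quotient_ring idI I1.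
pose f (x : R) : Q := (\pi_({ideal_quot quotient_pred I})%qT x).
have fD x y : f (x + y) = f x + f y by exact: quotient_piD.
have fE x y : f x = f y <-> I (x - y) by exact: quotient_piP.
have f0 : f 0 = 0 by apply: (addrI (f 0)); rewrite -fD !addr0.
have [||F FE] := @rmorphism_of R Q f.
- by move=> x y; apply: (addIr (f y)); rewrite -fD !addrNK.
- by split=> // x y; exact: quotient_piM.
exists Q, F; split; apply/seteqP; split=> // x.
- move: x; apply: quotient_ind => x _; exists x => //; exact: FE.
- by move=> /=; rewrite FE -f0 fE subr0.
- by move=> /= Ix; rewrite FE -f0; apply/fE; rewrite subr0.
Qed.

Section CornerRing.
Variables (R : nzRingType) (e : R).
Hypotheses (ee : e * e = e) (e0 : e != 0).

(** For idempotent [e] the fixed points of [x -> e x e] form the corner [eRe]. Its unit is [e], so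
    it is an additive subgroup of [R] but in general not a subring. *)
Definition corner_pred : {pred R} := [pred x | e * x * e == x].

Lemma corner_pred_zmod_closed : zmod_closed corner_pred.
Proof.
split=> [|x y]; rewrite !inE ?mulr0 ?mul0r// => /eqP xE /eqP yE.
by rewrite mulrBr mulrBl xE yE.
Qed.

HB.instance Definition _ :=
  GRing.isZmodClosed.Build R corner_pred corner_pred_zmod_closed.

Record corner := Corner {corner_val : R; _ : corner_val \in corner_pred}.
HB.instance Definition _ := [isSub for corner_val].
HB.instance Definition _ := [Choice of corner by <:].
HB.instance Definition _ := [SubChoice_isSubZmodule of corner by <:].

(** As for [quotient_ring], the type carries the proofs that the ring instance needs. *)
Definition corner_ring of e * e = e & e != 0 := corner.
Local Notation Q := (corner_ring ee e0).
HB.instance Definition _ := GRing.Zmodule.on Q.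

Lemma corner1_subproof : e \in corner_pred.
Proof. by rewrite inE !ee. Qed.
Lemma corner_idl (x : Q) : e * val x = val x.
Proof. by have /eqP <- := valP x; rewrite !mulrA ee. Qed.
Lemma corner_idr (x : Q) : val x * e = val x.
Proof. by have /eqP <- := valP x; rewrite -!mulrA ee. Qed.
Lemma cornerM_subproof (x y : Q) : val x * val y \in corner_pred.
Proof. by rewrite inE mulrA corner_idl -mulrA corner_idr. Qed.

Definition corner1 : Q := Corner corner1_subproof.
Definition corner_mul (x y : Q) : Q := Corner (cornerM_subproof x y).

Lemma corner_mulA : associative corner_mul.
Proof. by move=> x y z; apply: val_inj; rewrite /= mulrA. Qed.
Lemma corner_mul1l : left_id corner1 corner_mul.
Proof. by move=> x; apply: val_inj; exact: corner_idl. Qed.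
Lemma corner_mul1r : right_id corner1 corner_mul.
Proof. by move=> x; apply: val_inj; exact: corner_idr. Qed.
Lemma corner_mulDl : left_distributive corner_mul +%R.
Proof. by move=> x y z; apply: val_inj; rewrite /= mulrDl. Qed.
Lemma corner_mulDr : right_distributive corner_mul +%R.
Proof. by move=> x y z; apply: val_inj; rewrite /= mulrDr. Qed.
Lemma corner_1neq0 : corner1 != 0.
Proof. by rewrite -(inj_eq val_inj). Qed.

HB.instance Definition _ := GRing.Zmodule_isNzRing.Build Q
  corner_mulA corner_mul1l corner_mul1r corner_mulDl corner_mulDr
  corner_1neq0.

End CornerRing.

(** The inclusion [i] sends [1] to [e], so it is not a ring morphism in general; its compatibility
    with products is listed separately. *)
Lemma corner_ring_exists (R : nzRingType) (e : R) : e * e = e -> e != 0 ->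
  exists (D : nzRingType) (i : {additive D -> R}),
    [/\ injective i, forall x, i (x : D) = e * i x * e,
        forall x, exists d, i d = e * x * e,
        i 1 = e & {morph i : x y / x * y}].
Proof.
move=> ee e0; pose D : nzRingType := corner_ring ee e0.
exists D, (val : {additive D -> R}); split=> //.
- by move=> x; have /eqP -> := valP x.
- move=> x; have h : e * x * e \in corner_pred e by rewrite inE !mulrA ee -!mulrA ee.
  by exists (Corner h).
Qed.

(** * Rings that are sums of two minimal left ideals *)

Lemma surj_inj_bij (A B : Type) (f : A -> B) :
  injective f -> (forall y, exists x, f x = y) -> bijective f.
Proof.
move=> fI /choice[g gK]; exists g => // x; exact: fI.
Qed.

(** The map runs from [S] to [R] because a matrix or a pair determines an element of [R] by an
    explicit formula; the inverse comes from choice. *)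
Lemma ring_isomorphic_from (R S : nzRingType) (f : S -> R) :
    zmod_morphism f -> monoid_morphism f -> injective f ->
    (forall y, exists x, f x = y) ->
  ring_isomorphic R S.
Proof.
move=> fB fM fI fS; have [F FE] := rmorphism_of fB fM.
have [|y|g fK gK] := @surj_inj_bij _ _ F.
- by move=> x y; rewrite !FE => /fI.
- by have [x <-] := fS y; exists x.
have [G GE] := rmorphism_of (can2_zmod_morphism fK gK) (can2_monoid_morphism fK gK).
by exists G, F => x; rewrite GE.
Qed.

Section Minimal.
Variable R : nzRingType.
Implicit Types S B : set R.

Lemma minimal_principal S x : minimal_left_ideal S -> S x -> x <> 0 -> S = principal x.
Proof.
move=> [Sl _ Smin] Sx x0; have lx := left_ideal_principal x.
case: (Smin _ lx (principal_sub Sl Sx)) => // px0; case: x0.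
by have := principal_id x; rewrite px0.
Qed.

Lemma minimal_generator S : minimal_left_ideal S ->
  exists x, [/\ S x, x <> 0 & S = principal x].
Proof.
move=> Smin; case: (Smin) => Sl Sn0 _.
have [x Sx /eqP x0] := (left_ideal_neq0 Sl).2 Sn0.
by exists x; split=> //; apply: minimal_principal.
Qed.

(** Schur's lemma in terms of elements. A nonzero [x] in [eRe] generates [Re], so [e = r x] for some
    [r], and [e r e] is a left inverse of [x] in the corner. *)
Lemma corner_division_ring (e : R) : e * e = e -> minimal_left_ideal (principal e) ->
  exists (D : nzRingType) (i : {additive D -> R}), division_ring D /\
    [/\ injective i, forall x, i (x : D) = e * i x * e,
        forall x, exists d, i d = e * x * e,
        i 1 = e & {morph i : x y / x * y}].
Proof.
move=> ee emin; have e0 : e != 0.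
  apply/eqP => e0; case: emin => _ + _; apply; apply/seteqP; split=> [_ [r _ <-]|_ ->].
    by rewrite /= e0 mulr0.
  by exists 0; rewrite ?mul0r.
have [D [i [iI iE iS i1 iM]]] := corner_ring_exists ee e0.
exists D, i; split=> //; apply: left_inv_division_ring => x x0.
have ix0 : i x <> 0 by move=> ix0; case/eqP: x0; apply: iI; rewrite ix0 raddf0.
have ex : principal e (i x) by rewrite iE; exists (e * i x).
have := principal_id e; rewrite (minimal_principal emin ex ix0) => -[r _ rx].
have [y yE] := iS r; exists y; apply: iI; rewrite iM yE i1.
have eix : e * i x = i x by rewrite iE !mulrA ee.
by rewrite -!mulrA eix rx ee.
Qed.

(** The products [q i * p j] are matrix units. The isomorphism sends a matrix with entries [a_ij] in
    [eRe] to the sum of the [q_i a_ij p_j], and the entries of [x] are recovered as [p_i x q_j]. *)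
Lemma matrix_units_ring_iso n (e : R) (p q : 'I_n.+1 -> R) :
    e * e = e -> minimal_left_ideal (principal e) ->
    (forall i j, p i * q j = e *+ (i == j)) -> \sum_i q i * p i = 1 ->
    (forall i, e * p i = p i) -> (forall i, q i * e = q i) ->
  exists D, division_ring D /\ ring_isomorphic R 'M[D]_n.+1.
Proof.
move=> ee emin pq qp ep qe.
have [D [c [Ddiv [cI cE cS c1 cM]]]] := corner_division_ring ee emin.
exists D; split=> //.
pose f (A : 'M[D]_n.+1) := \sum_i \sum_j q i * c (A i j) * p j.
have pfq A i j : p i * f A * q j = c (A i j).
  rewrite mulr_sumr mulr_suml (bigD1 i) //= [X in _ + X]big1 => [|k ki].
    rewrite addr0 mulr_sumr mulr_suml (bigD1 j) //= [X in _ + X]big1 => [|k kj].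
      by rewrite addr0 !mulrA pq eqxx -!mulrA pq eqxx mulr1n mulrA -cE.
    by rewrite -!mulrA pq (negPf kj) !mulr0.
  rewrite mulr_sumr mulr_suml big1 // => l _.
  by rewrite !mulrA pq eq_sym (negPf ki) !mul0r.
have fI : injective f.
  by move=> A B AB; apply/matrixP => i j; apply: cI; rewrite -!pfq AB.
(* Inserting [1], as the sum of the [q i * p i], on both sides of [x] shows that its entries
   determine it. *)
have ext x y : (forall i j, p i * x * q j = p i * y * q j) -> x = y.
  move=> h; rewrite -[x]mulr1 -[y]mulr1 -[x]mul1r -[y]mul1r -qp.
  rewrite !mulr_suml; apply: eq_bigr => i _; rewrite !mulr_sumr.
  apply: eq_bigr => j _; rewrite !mulrA -!(mulrA (q i)) h //.
apply: (@ring_isomorphic_from _ _ f) => //.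
- by move=> A B; apply: ext => i j; rewrite mulrBr mulrBl !pfq !mxE raddfB.
- split; first by apply: ext => i j; rewrite pfq mulr1 pq mxE raddfMn c1.
  move=> A B; apply: ext => i j; rewrite pfq mxE raddf_sum.
  rewrite -[f A]mulr1 -qp mulr_sumr mulr_suml mulr_sumr mulr_suml.
  apply: eq_bigr => k _; rewrite cM -!pfq !mulrA //.
- move=> x; have h i j : exists d, c d = p i * x * q j.
    by have [d dE] := cS (p i * x * q j); exists d; rewrite dE !mulrA ep -!mulrA qe.
  have /choice [g gE] : forall ij, exists d, c d = p ij.1 * x * q ij.2.
    by move=> ij; apply: h.
  exists (\matrix_(i, j) g (i, j)); apply: ext => i j.
  by rewrite pfq mxE gE.
Qed.

(** Right multiplication by [w = e u f] is a nonzero map from [Re] to [Rf], hence an isomorphism by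
    minimality; its inverse is right multiplication by the [v] with [v w = f] and [w v = e]. *)
Lemma off_diagonal_matrix_ring (e f u : R) :
    e * e = e -> f * f = f -> e + f = 1 -> e * f = 0 -> f * e = 0 ->
    minimal_left_ideal (principal e) -> minimal_left_ideal (principal f) ->
    e * u * f <> 0 ->
  type_ii R.
Proof.
move=> ee ff ef1 ef fe emin fmin; set w := e * u * f => w0.
have ew : e * w = w by rewrite /w !mulrA ee.
have wf : w * f = w by rewrite /w -!mulrA ff.
have fw : principal f w by exists (e * u).
have := principal_id f; rewrite (minimal_principal fmin fw w0) => -[v0 _ v0w].
pose v := f * v0 * e.
have vw : v * w = f by rewrite /v -!mulrA ew v0w ff.
have wvn0 : w * v <> 0 by move=> wv; apply: w0; rewrite -wf -vw mulrA wv mul0r.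
have ewv : principal e (w * v) by exists (w * f * v0) => //; rewrite /v !mulrA.
have := principal_id e; rewrite (minimal_principal emin ewv wvn0) => -[r _ rwv].
have fv : f * v = v by rewrite /v !mulrA ff.
have ve : v * e = v by rewrite /v -!mulrA ee.
(* Since [v w = f], the element [w v] is idempotent; so [e = r w v] gives
   [e w v = r w v w v = r w v = e]. *)
have wv : w * v = e.
  rewrite -[LHS](_ : e * (w * v) = _); last by rewrite mulrA ew.
  by rewrite -rwv -mulrA -(mulrA w v) (mulrA v w) vw fv.
(* With [p = (e, w)] and [q = (e, v)] the four matrix units [q i * p j] are [e], [w], [v] and
   [v w = f]. *)
left; pose p (i : 'I_2) := if i == 0 then e else w.
pose q (i : 'I_2) := if i == 0 then e else v.
apply: (@matrix_units_ring_iso 1 e p q) => //.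
- move=> i j; rewrite /p /q.
  case: i => [[|[|//]] ?]; case: j => [[|[|//]] ?] //=.
  + by rewrite -fv mulrA ef mul0r.
  + by rewrite -wf -mulrA fe mulr0.
- by rewrite big_ord_recl big_ord1 /p /q /= ee vw.
- by move=> i; rewrite /p; case: ifP.
- by move=> i; rewrite /q; case: ifP.
Qed.

(** In the Peirce decomposition of [R] only the two diagonal corners survive, and they annihilate
    each other. *)
Lemma diagonal_sum_ring (e f : R) :
    e * e = e -> f * f = f -> e + f = 1 -> e * f = 0 -> f * e = 0 ->
    minimal_left_ideal (principal e) -> minimal_left_ideal (principal f) ->
    (forall x, e * x * f = 0) -> (forall x, f * x * e = 0) ->
  type_ii R.
Proof.
move=> ee ff ef1 ef fe emin fmin exf fxe.
have [D1 [c [D1div [cI cE cS c1 cM]]]] := corner_division_ring ee emin.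
have [D2 [d [D2div [dI dE dS d1 dM]]]] := corner_division_ring ff fmin.
right; exists D1, D2; split=> //.
have cd x y : c x * d y = 0 by rewrite cE dE -!mulrA (mulrA e f) ef mul0r !mulr0.
have dc x y : d y * c x = 0 by rewrite cE dE -!mulrA (mulrA f e) fe mul0r !mulr0.
apply: (@ring_isomorphic_from _ _ (fun x => c x.1 + d x.2)).
- by move=> x y /=; rewrite !raddfB /= opprD addrACA.
- split; first by rewrite c1 d1.
  by move=> x y /=; rewrite cM dM mulrDl !mulrDr cd dc addr0 add0r.
- have ec x : e * c x = c x by rewrite cE !mulrA ee.
  have fd x : f * d x = d x by rewrite dE !mulrA ff.
  have ed x : e * d x = 0 by rewrite dE !mulrA ef !mul0r.
  have fc x : f * c x = 0 by rewrite cE !mulrA fe !mul0r.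
  move=> [x1 x2] [y1 y2] /= h; congr (_, _).
    by apply: cI; move/(congr1 (fun z => e * z)): h; rewrite !mulrDr !ec !ed !addr0.
  by apply: dI; move/(congr1 (fun z => f * z)): h; rewrite !mulrDr !fc !fd !add0r.
- move=> x; have [a aE] := cS x; have [b bE] := dS x; exists (a, b) => /=.
  rewrite aE bE -[RHS]mulr1 -[x in RHS]mul1r -ef1 mulrDl !mulrDr.
  by rewrite !mulrDl exf fxe addr0 add0r.
Qed.

Lemma complementary_minimal_type_ii (I J : set R) :
    minimal_left_ideal I -> minimal_left_ideal J ->
    I `&` J = [set 0] -> left_sum I J = setT ->
  type_ii R.
Proof.
move=> Imin Jmin IJ0 IJT; case: (Imin) (Jmin) => [Il _ _] [Jl _ _].
have : left_sum I J 1 by rewrite IJT.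
move=> [e [f [Ie Jf /esym ef1]]].
have IJ x : I x -> J x -> x = 0 by move=> Ix Jx; have : (I `&` J) x by []; rewrite IJ0.
case: (Il) (Jl) => [_ ID IM] [_ JD JM].
(* With [1 = e + f], the element [x f = x - x e] lies in both [I] and [J]. This makes [e] and [f]
   orthogonal idempotents. *)
have Ixe x : I x -> x * f = 0.
  move=> Ix; apply: IJ; last exact: JM.
  have -> : x * f = x - x * e by rewrite -{2}[x]mulr1 -ef1 mulrDr addrAC subrr add0r.
  by apply: left_idealB => //; apply: IM.
have Jxf x : J x -> x * e = 0.
  move=> Jx; apply: IJ; first exact: IM.
  have -> : x * e = x - x * f by rewrite -{2}[x]mulr1 -ef1 mulrDr addrK.
  by apply: left_idealB => //; apply: JM.
have ef := Ixe e Ie; have fe := Jxf f Jf.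
have ee : e * e = e by rewrite -[RHS]mulr1 -ef1 mulrDr ef addr0.
have ff : f * f = f by rewrite -[RHS]mulr1 -ef1 mulrDr fe add0r.
have n0 S : minimal_left_ideal S -> S <> [set 0] by case.
have e0 : e <> 0.
  move=> e0; apply: (n0 I Imin); apply/seteqP; split=> [x Ix|_ ->]; last by case: Il.
  by rewrite /= -[x]mulr1 -ef1 mulrDr e0 mulr0 add0r Ixe.
have f0 : f <> 0.
  move=> f0; apply: (n0 J Jmin); apply/seteqP; split=> [x Jx|_ ->]; last by case: Jl.
  by rewrite /= -[x]mulr1 -ef1 mulrDr f0 mulr0 addr0 Jxf.
have emin : minimal_left_ideal (principal e) by rewrite -(minimal_principal Imin Ie e0).
have fmin : minimal_left_ideal (principal f) by rewrite -(minimal_principal Jmin Jf f0).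
(* [eRf] and [fRe] are the homomorphism groups between [Re] and [Rf]; a nonzero element in either
   makes these two minimal left ideals isomorphic. *)
have [h1|/existsNP [u h1]] := pselect (forall x, e * x * f = 0); last first.
  exact: (@off_diagonal_matrix_ring e f u).
have [h2|/existsNP [u h2]] := pselect (forall x, f * x * e = 0); last first.
  by apply: (@off_diagonal_matrix_ring f e u) => //; rewrite addrC.
exact: (@diagonal_sum_ring e f).
Qed.

End Minimal.

(** * Rings with a largest proper left ideal *)

Section Local.
Variables (R : nzRingType) (B : set R).
Hypotheses (Bl : left_ideal B) (B1 : ~ B 1).
Hypothesis Bmax : forall I, left_ideal I -> I <> setT -> I `<=` B.

Lemma local_left_inv x : ~ B x -> exists y, y * x = 1.
Proof.
move=> Bx; have : [set: R] 1 by [].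
have [<- [y _ <-]|xT] := pselect (principal x = setT); first by exists y.
by case: Bx; apply: Bmax (principal_id x) => //; apply: left_ideal_principal.
Qed.

(** The property of the Jacobson radical that drives the Nakayama arguments below: [1 - b] cannot
    lie in [B] along with [b]. *)
Lemma local_1sub_left_inv b : B b -> exists y, y * (1 - b) = 1.
Proof.
move=> Bb; apply: local_left_inv => B1b; apply: B1.
by rewrite -(subrK b 1); case: Bl => _ BD _; apply: BD.
Qed.

(** If [b r] were outside [B], then [s b r = 1] for some [s]. Now [(1 - r s b) r = 0] while
    [1 - r s b] is left invertible, so [r = 0], which is absurd. *)
Lemma local_ideal : ideal B.
Proof.
split=> // r b Bb; apply: contrapT => /local_left_inv [s sbr].
have Brsb : B (r * (s * b)) by case: Bl => _ _ BM; apply/BM/BM.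
have [t t1] := local_1sub_left_inv Brsb.
have r0 : r = 0.
  have rr : (1 - r * (s * b)) * r = 0.
    by rewrite mulrBl mul1r -!mulrA sbr mulr1 subrr.
  by rewrite -[r]mul1r -t1 -mulrA rr mulr0.
by move: (oner_neq0 R); rewrite -sbr r0 !mulr0 eqxx.
Qed.

(** Nakayama's lemma: if [b s] is nonzero it generates [S], so [s = r b s] and [(1 - r b) s = 0],
    which forces [s = 0]. *)
Lemma local_mul_minimal S b s : minimal_left_ideal S -> B b -> S s -> b * s = 0.
Proof.
move=> Smin Bb Ss; apply: contrapT => bs0.
have [Sl _ _] := Smin; have Sbs : S (b * s) by case: Sl => _ _; apply.
move: (Ss); rewrite (minimal_principal Smin Sbs bs0) => -[r _ rbs].
have [|t t1] := @local_1sub_left_inv (r * b); first by case: Bl => _ _; apply.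
by apply: bs0; rewrite -[s]mul1r -t1 -mulrA mulrBl mul1r -mulrA rbs subrr !mulr0.
Qed.

(** [B] is prime because an ideal not inside it is all of [R]; conversely every prime contains the
    zero ideal [B^3], hence [B]. The cube is what vanishes in general, as [B^2] may be nonzero in
    type (i). *)
Lemma local_prime_radical : (forall a b c, B a -> B b -> B c -> a * b * c = 0) ->
  prime_radical R = B.
Proof.
move=> B3; have Bi := local_ideal; apply/seteqP; split=> x.
  apply; split=> [||I J [Il _] [Jl _] IJB]; first exact: Bi.
    by move=> BT; apply: B1; rewrite BT.
  have [IT|/(Bmax Il)] := pselect (I = setT); last by left.
  right=> y Jy; apply: IJB; rewrite -[y]mul1r; apply: ideal_mul_mem => //.
  by rewrite IT.
move=> Bx P [[Pl _] _ Pprime].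
have B2P : ideal_mul B (ideal_mul B B) `<=` P.
  apply: ideal_mul_sub => // a y Ba [n [b [c [Bb Bc ->]]]].
  rewrite mulr_sumr big1 => [|i _]; first by case: Pl.
  by rewrite mulrA B3.
case: (Pprime _ _ Bi (ideal_mul_ideal Bi Bi) B2P) => [|BP]; first exact.
by case: (Pprime _ _ Bi Bi BP) => h; apply: h.
Qed.

Lemma local_quotient (D : nzRingType) (pi : {rmorphism R -> D}) :
  is_quotient_map B pi -> division_ring D.
Proof.
move=> [piT piB]; apply: left_inv_division_ring => d.
have [r _ <- r0] : range pi d by rewrite piT.
have [|s sr] := @local_left_inv r.
  by rewrite -piB => /= /eqP; apply/negP.
by exists (pi s); rewrite -rmorphM sr rmorph1.
Qed.

(** The annihilator of [x] is [B], so [Rx] is a copy of [R/B]. The isomorphism multiplies [x] by a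
    chosen lift [s d] of [d], and [piE] shows that any other lift gives the same element. *)
Lemma principal_iso (D : nzRingType) (pi : {rmorphism R -> D}) x :
    is_quotient_map B pi -> (forall r, r * x = 0 <-> B r) ->
  isomorphic_over_ring pi (principal x) /\ isomorphic_over_quotient pi (principal x).
Proof.
move=> [piT piB] annx.
have /choice [s sK] : forall d, exists r, pi r = d.
  by move=> d; have [|r _ <-] := (_ : range pi d); [rewrite piT|exists r].
have piE r r' : pi r = pi r' <-> r * x = r' * x.
  split=> [/eqP|/eqP]; rewrite -subr_eq0 => /eqP h.
    by apply/eqP; rewrite -subr_eq0 -mulrBl; apply/eqP/annx; rewrite -piB /= rmorphB.
  apply/eqP; rewrite -subr_eq0 -rmorphB; apply/eqP.
  by have := (annx (r - r')).1; rewrite mulrBl h -piB; apply.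
have [|phi phiE] := @additive_of D R (fun d => s d * x).
  by move=> d d'; rewrite -mulrBl; apply/piE; rewrite rmorphB !sK.
have phiI : injective phi by move=> d d'; rewrite !phiE => /piE; rewrite !sK.
have phiS : range phi = principal x.
  apply/seteqP; split=> [_ [d _ <-]|_ [r _ <-]]; first by exists (s d).
  by exists (pi r) => //; rewrite phiE; apply/piE; rewrite sK.
split; first exists phi.
  split=> // r d; rewrite !phiE mulrA; apply/piE.
  by rewrite rmorphM !sK.
exists (fun d y => s d * y); split=> [r _ [t _ <-]|].
  by rewrite !mulrA; apply/piE; rewrite !rmorphM sK.
exists phi; split=> // c d; rewrite !phiE mulrA; apply/piE.
by rewrite rmorphM !sK.
Qed.

Lemma local_type_iii (S1 S2 : set R) :
    (forall a b, B a -> B b -> a * b = 0) ->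
    minimal_left_ideal S1 -> minimal_left_ideal S2 -> is_direct_sum B S1 S2 ->
  type_iii R.
Proof.
move=> B2 S1min S2min dS.
have betaB : prime_radical R = B.
  by apply: local_prime_radical => a b c Ba Bb _; rewrite (B2 a b) ?mul0r.
have [D [pi piP]] := quotient_ring_exists local_ideal B1.
exists D; split; first exact: local_quotient piP.
exists pi; rewrite betaB //; split.
  apply/seteqP; split=> [|_ ->]; last by case: (ideal_mul_left_ideal B Bl).
  apply: ideal_mul_sub => [|a b Ba Bb] /=; last exact: B2.
  by split=> //= [x y -> ->|r x ->]; rewrite ?addr0 ?mulr0.
(* A generator [x] of [S] has annihilator exactly [B]: [B] kills minimal left ideals, and an element
   outside [B] is left invertible. *)
have iso S : minimal_left_ideal S ->
    isomorphic_over_ring pi S /\ isomorphic_over_quotient pi S.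
  move=> Smin; have [x [Sx x0 ->]] := minimal_generator Smin.
  apply: principal_iso => // r; split=> [rx|Br]; last exact: local_mul_minimal Br Sx.
  apply: contrapT => /local_left_inv [y yr]; apply: x0.
  by rewrite -[x]mul1r -yr -mulrA rx mulr0.
have [iso1 iso1'] := iso _ S1min; have [iso2 iso2'] := iso _ S2min.
by exists S1, S2.
Qed.

End Local.

(** * Triangle-free intersection graphs *)

Lemma sub_neqT (T : Type) (I J : set T) : I `<=` J -> J <> setT -> I <> setT.
Proof. by move=> IJ JT e; apply: JT; apply/seteqP; split=> //; rewrite -e. Qed.

Lemma sub_neq0 (R : nzRingType) (I J : set R) :
  left_ideal I -> I `<=` J -> I <> [set 0] -> J <> [set 0].
Proof.
move=> [I0 _ _] IJ In0 J0; apply: In0; apply/seteqP; split=> [x /IJ|_ ->//].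
by rewrite J0.
Qed.

Section TriangleFree.
Variable R : nzRingType.
Hypothesis tf : triangle_free (intersection_graph R).
Local Notation nontrivial := (@nontrivial_left_ideal R).
Implicit Types I J K A B C : set R.

(** All three pairwise intersections contain [I]. Every later appeal to triangle-freeness goes
    through this triangle. *)
Lemma no_common_sub I J K : nontrivial I -> nontrivial J -> nontrivial K ->
  I `<=` J -> I `<=` K -> I <> J -> J <> K -> I <> K -> False.
Proof.
move=> nI nJ nK IJ IK InJ JnK InK; apply: tf; case: (nI) => [Il I0 _].
exists (exist _ I nI), (exist _ J nJ), (exist _ K nK).
split; split; first [by move=> []|split; first by move=> []].
- by rewrite /= setIidl.
- by apply: (sub_neq0 Il _ I0); rewrite /= subsetI.
- by rewrite /= setIidl.
Qed.

Lemma no_chain A B C : nontrivial A -> nontrivial B -> nontrivial C ->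
  A `<=` B -> B `<=` C -> A <> B -> B <> C -> False.
Proof.
move=> nA nB nC AB BC AnB BnC.
apply: (@no_common_sub A B C) => //; first exact: subset_trans BC.
by move=> e; apply: AnB; apply/seteqP; split=> //; rewrite e.
Qed.

Lemma atomic_case : (forall I J, nontrivial I -> nontrivial J -> I `<=` J -> I = J) ->
  type_i R \/ type_ii R.
Proof.
move=> inclE; have minat I : nontrivial I -> minimal_left_ideal I.
  move=> nI; case: (nI) => Il I0 IT; split=> // J Jl JI.
  have [->|J0] := pselect (J = [set 0]); [by left|right; apply: (inclE _ _) => //].
  by split=> //; apply: sub_neqT JI IT.
have [[I nI]|/forallNP none] := pselect (exists I, nontrivial I); last first.
  left; constructor 1; apply: left_inv_division_ring => x /eqP x0.
  have [pT|pT] := pselect (principal x = setT).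
    by have : [set: R] 1 by []; rewrite -pT => -[y _ <-]; exists y.
  case: (none (principal x)); split=> //; first exact: left_ideal_principal.
  by move=> p0; apply: x0; have := principal_id x; rewrite p0.
case: (nI) => Il I0 IT.
have [one|/existsNP [J /not_implyP [nJ JI]]] := pselect (forall J, nontrivial J -> J = I).
  left; constructor 2.
  suff betaI : prime_radical R = I.
    by rewrite /one_nontrivial_left_ideal betaI => J; split=> [/one//|->].
  have I1 : ~ I 1 by move/(left_ideal1 Il).
  have Imax J : left_ideal J -> J <> setT -> J `<=` I.
    move=> Jl JT; have [->|J0] := pselect (J = [set 0]); first by case: Il => ? _ _ _ ->.
    by rewrite (one J).
  (* [I] is both the largest proper left ideal and minimal, so already [I^2 = 0]. *)
  apply: local_prime_radical => // a b c Ia Ib Ic.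
  by rewrite (local_mul_minimal Il I1 Imax (minat _ nI) Ia Ib) mul0r.
right; case: (nJ) => Jl J0 JT; apply: (@complementary_minimal_type_ii _ I J).
- exact: minat.
- exact: minat.
(* A nonzero [I & J] would be nontrivial and contained in both, hence equal to [I], so that [I]
   would lie in [J]. The sum is treated dually. *)
- apply: contrapT => IJ0; apply: JI; symmetry; apply: (inclE _ _) => //.
  have nIJ : nontrivial (I `&` J).
    split=> //; first exact: left_idealI.
    by apply: (sub_neqT (@subIsetl _ _ _)) IT.
  have <- : I `&` J = I by apply: (inclE _ _).
  exact: subIsetr.
- apply: contrapT => sT; apply: JI; apply: (inclE _ _) => //.
  have ns : nontrivial (left_sum I J).
    split=> //; first exact: left_ideal_sum.
    by apply: (sub_neq0 Il _ I0); apply: left_sumSl.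
  have -> : I = left_sum I J by apply: (inclE _ _) => //; apply: left_sumSl.
  exact: left_sumSr.
Qed.

Section Chain.
Variables A B : set R.
Hypotheses (nA : nontrivial A) (nB : nontrivial B) (AB : A `<=` B) (AnB : A <> B).

Lemma chain_max C : nontrivial C -> C `<=` B.
Proof.
move=> nC; case: (nA) (nB) (nC) => [Al A0 AT] [Bl B0 BT] [Cl C0 CT].
apply: contrapT => CB.
(* If [B & C] is nonzero, it is either [B], which gives the chain [A < B < C], or a left ideal
   common to the incomparable [B] and [C]. *)
have CnB : C <> B by move=> e; apply: CB; rewrite e.
have [BC0|BC0] := pselect (B `&` C = [set 0]); last first.
  have nBC : nontrivial (B `&` C).
    split=> //; first exact: left_idealI.
    by apply: (sub_neqT (@subIsetl _ _ _)) BT.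
  have [BCB|BCnB] := pselect (B `&` C = B).
    by apply: (@no_chain A B C) => //; [rewrite -BCB|move=> /esym].
  apply: (@no_common_sub (B `&` C) B C) => //; first exact: nesym.
  by move=> e; apply: CB; rewrite -e.
(* Otherwise [B] and [A + C] would be two nontrivial left ideals above [A]. Once the sum is [R], the
   modular law gives [B = A + (B & C) = A]. *)
have AsC : left_sum A C = setT.
  apply: contrapT => sT; have ns : nontrivial (left_sum A C).
    split=> //; first exact: left_ideal_sum.
    by apply: (sub_neq0 Al _ A0); apply: left_sumSl.
  have AS := @left_sumSl _ A _ Cl; have CS := @left_sumSr _ _ C Al.
  have Csub X : left_sum A C = X -> C `<=` X by move=> <-.
  apply: (@no_common_sub A B (left_sum A C)) => //.
  + by move=> /esym /Csub.
  + by move=> /esym /Csub CA; apply: CB; apply: subset_trans AB.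
apply: AnB; apply/seteqP; split=> // x Bx.
have [a [c [Aa Cc xac]]] : left_sum A C x by rewrite AsC.
have : (B `&` C) c.
  split=> //; have -> : c = x - a by rewrite xac addrAC subrr add0r.
  by apply: left_idealB => //; apply: AB.
by rewrite BC0 => c0; rewrite xac c0 addr0.
Qed.

Lemma chain_minimal S : nontrivial S -> S <> B -> minimal_left_ideal S.
Proof.
move=> nS SB; case: (nS) => Sl S0 ST; split=> // I Il IS.
apply: contrapT => /not_orP [I0 InS].
apply: (@no_chain I S B) => //; last exact: chain_max.
by split=> //; apply: sub_neqT IS ST.
Qed.

(** Otherwise [S < S + J < B] would be a chain of three. *)
Lemma chain_sum S J : nontrivial S -> left_ideal J -> J `<=` B -> ~ (J `<=` S) ->
  left_sum S J = B.
Proof.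
move=> nS Jl JB JS; case: (nS) (nB) => [Sl S0 ST] [Bl B0 BT].
have sB : left_sum S J `<=` B.
  move=> _ [s [t [Ss Jt ->]]]; case: (Bl) => _ BD _.
  by apply: BD; [exact: chain_max Ss|exact: JB].
apply: contrapT => SnB; apply: (@no_chain S (left_sum S J) B) => //.
- split; [exact: left_ideal_sum| |exact: sub_neqT sB BT].
  by apply: (sub_neq0 Sl _ S0); apply: left_sumSl.
- exact: left_sumSl.
- by move=> e; apply: JS; rewrite e; apply: left_sumSr.
Qed.

Lemma chain_case : type_i R \/ type_iii R.
Proof.
case: (nB) => Bl B0 BT; have B1 : ~ B 1 by move/(left_ideal1 Bl).
have Bmax I : left_ideal I -> I <> setT -> I `<=` B.
  move=> Il IT; have [->|I0] := pselect (I = [set 0]); first by case: Bl => ? _ _ _ ->.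
  exact: chain_max.
(* If [b x] were outside [S], then [S + R b x = B] would contain [x = s + r b x]. Since [1 - r b] is
   left invertible, [x] and then [b x] would lie in [S]. *)
have mulS S b x : nontrivial S -> S <> B -> B b -> B x -> S (b * x).
  move=> nS SnB Bb Bx; apply: contrapT => Sbx; have [Sl _ _] := nS.
  have Bbx : B (b * x) by case: Bl => _ _; apply.
  have sB : left_sum S (principal (b * x)) = B.
    apply: chain_sum => //; first exact: left_ideal_principal.
      exact: principal_sub.
    by move/(_ _ (principal_id _)).
  move: (Bx); rewrite -sB => -[s [_ [Ss [r _ <-] xE]]].
  have [|t t1] := local_1sub_left_inv Bl B1 Bmax (b := r * b).
    by case: Bl => _ _; apply.
  have tsx : t * s = x.
    have -> : s = x - r * b * x by apply: (canRL (addrK _)); rewrite -mulrA.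
    by rewrite -{1}[x]mul1r -mulrBl mulrA t1 mul1r.
  by apply: Sbx; case: Sl => _ _ SM; rewrite -tsx; apply/SM/SM.
have nS_mul S b x : nontrivial S -> S <> B -> B b -> S x -> b * x = 0.
  by move=> nS SnB Bb Sx; apply: (local_mul_minimal Bl B1 Bmax (chain_minimal nS SnB)) Bb Sx.
(* The cube vanishes because [b c] lies in the minimal left ideal [A], which [B] annihilates. *)
have betaB : prime_radical R = B.
  apply: local_prime_radical => // a b c Ba Bb Bc; rewrite -mulrA.
  by apply: (nS_mul A) => //; apply: mulS.
have [B2|/existsNP [a /existsNP [b /not_implyP [Ba /not_implyP [Bb ab0]]]]] :=
    pselect (forall a b, B a -> B b -> a * b = 0).
  right; have [x [Bx Ax]] : exists x, B x /\ ~ A x.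
    apply: contrapT => /forallNP h; apply: AnB; apply/seteqP; split=> // x Bx.
    by apply: contrapT => Ax; apply: (h x).
  have lx := left_ideal_principal x.
  have xB : principal x `<=` B by apply: principal_sub.
  have xA : ~ (principal x `<=` A) by move/(_ _ (principal_id x)).
  have Amin := chain_minimal nA AnB; have [Al A0 _] := nA.
  have x0 : x <> 0 by move=> x0; apply: Ax; rewrite x0; case: Al.
  (* A nonzero [r x] has [r] outside [B], since [B^2 = 0]; so [r] is left invertible and [r x]
     generates [Rx]. *)
  have xmin : minimal_left_ideal (principal x).
    split=> // [e|I Il Ix]; first by apply: x0; have := principal_id x; rewrite e.
    have [->|In0] := pselect (I = [set 0]); [by left|right].
    have [y Iy /eqP y0] := (left_ideal_neq0 Il).2 In0.
    have [r _ rx] := Ix _ Iy.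
    have [|s sr] := local_left_inv Bmax (x := r).
      by move=> Br; apply: y0; rewrite -rx B2.
    apply/seteqP; split=> //; apply: principal_sub => //.
    by rewrite -[x]mul1r -sr -mulrA rx; case: Il => _ _; apply.
  apply: (local_type_iii Bl B1 Bmax B2 Amin xmin); split.
    exact/esym/(chain_sum nA lx xB xA).
  (* Two minimal left ideals meet in zero or coincide, and [x] is not in [A]. *)
  have [_ _ Amin'] := Amin.
  case: (Amin' (A `&` principal x)) => //; first exact: left_idealI.
  move=> AxA; case: (Ax); have [_ _ xmin'] := xmin.
  case: (xmin' (A `&` principal x)) => // [|e|e]; first exact: left_idealI.
    by case: A0; rewrite -AxA e.
  by have := principal_id x; rewrite -e => -[].
left; constructor 3; rewrite /two_nontrivial_left_ideals betaB.
(* Here [B^2] is nonzero and lies in the minimal left ideal [S], so it equals [S]. *)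
have B2S S : nontrivial S -> S <> B -> S = ideal_mul B B.
  move=> nS SnB; have [Sl _ Smin] := chain_minimal nS SnB.
  case: (Smin (ideal_mul B B)) => //; first exact: ideal_mul_left_ideal.
    by apply: ideal_mul_sub => // *; apply: mulS.
  by move=> e; case: ab0; have := ideal_mul_mem Ba Bb; rewrite e.
split; first by rewrite -(B2S A) // => e; apply: AnB.
move=> I; split=> [nI|[->//|->]]; last by rewrite -(B2S A).
by have [->|InB] := pselect (I = B); [left|right; apply: B2S].
Qed.

End Chain.

Lemma triangle_free_types : [\/ type_i R, type_ii R | type_iii R].
Proof.
have [inclE|/existsNP [A /existsNP [B h]]] :=
  pselect (forall I J, nontrivial I -> nontrivial J -> I `<=` J -> I = J).
  by case: (atomic_case inclE) => h; [constructor 1|constructor 2].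
have [nA /not_implyP [nB /not_implyP [AB AnB]]] := (not_implyP _ _).1 h.
by case: (chain_case nA nB AB AnB) => {}h; [constructor 1|constructor 3].
Qed.

End TriangleFree.

(** * Intersection graphs of the three types *)

Section GraphIso.
Implicit Types G H K : simple_graph.

Lemma graph_iso_trans G H K : graph_iso G H -> graph_iso H K -> graph_iso G K.
Proof.
move=> [f fb fE] [g gb gE]; exists (g \o f); first exact: bij_comp.
by move=> x y; rewrite fE gE.
Qed.

(** Being edgeless and being complete are the isomorphism invariants that will separate the three
    types. *)
Definition edgeless G := forall x y : vertex G, ~ adj x y.
Definition complete G := forall x y : vertex G, x <> y -> adj x y.

Lemma edgeless_iso G H : graph_iso G H -> edgeless G <-> edgeless H.
Proof.
move=> [f [g fK gK] fE]; split=> h x y; last by rewrite fE.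
by rewrite -(gK x) -(gK y) -fE.
Qed.

Lemma complete_iso G H : graph_iso G H -> complete G <-> complete H.
Proof.
move=> [f [g fK gK] fE]; split=> h x y xy.
  by rewrite -(gK x) -(gK y) -fE; apply: h => /(can_inj gK).
by rewrite fE; apply: h => /(can_inj fK).
Qed.

Lemma triangle_free_iso G H : graph_iso G H -> triangle_free H -> triangle_free G.
Proof.
move=> [f [g fK _] fE] tf [x [y [z [[xy yz xz] [axy ayz axz]]]]]; apply: tf.
exists (f x), (f y), (f z).
by split; split; first [by move=> /(can_inj fK)|exact/fE].
Qed.

Lemma edgeless_triangle_free G : edgeless G -> triangle_free G.
Proof. by move=> e [x [y [z [_ [/e]]]]]. Qed.

Lemma complete_triangle_free n : (n <= 2)%N -> triangle_free (complete_graph 'I_n).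
Proof.
move=> n2 [x [y [z [[/eqP xy /eqP yz /eqP xz] _]]]].
have u3 : uniq [:: x; y; z] by rewrite /= !inE negb_or xy yz xz.
by have := max_card [in [:: x; y; z]]; rewrite (card_uniqP u3) card_ord leqNgt ltnS n2.
Qed.

Lemma star_triangle_free (V : Type) (c : V) : triangle_free (star_graph c).
Proof.
move=> [x [y [z [[xy yz xz] [[_ axy] [_ ayz] [_ axz]]]]]].
by case: axy ayz axz => ? [] ? [] ?; congruence.
Qed.

(** The graphs of the concrete rings below are found by listing their nontrivial left ideals through
    such a [g]. Equality of vertices is equality of the underlying sets, by proof irrelevance. *)
Lemma graph_iso_of_parametrization (R : nzRingType) G (g : vertex G -> set R) :
    injective g -> (forall I, nontrivial_left_ideal I <-> exists v, g v = I) ->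
    (forall v w, adj v w <-> v <> w /\ g v `&` g w <> [set 0]) ->
  graph_iso (intersection_graph R) G.
Proof.
move=> gI gS gA.
have gP v : nontrivial_left_ideal (g v) by apply/gS; exists v.
pose h v : ig_vertex R := exist _ (g v) (gP v).
have hI : injective h by move=> v w [] /gI.
have [|f hK fK] := @surj_inj_bij _ _ h hI.
  move=> [I nI]; have [v vI] := (gS I).1 nI; exists v.
  by apply: eq_exist.
exists f; first by exists h.
move=> x y; rewrite -{1}(fK x) -{1}(fK y) gA /= /ig_adj /=.
by split=> -[xy ?]; split=> // e; apply: xy; [rewrite e|apply: hI].
Qed.

End GraphIso.

(** * Transport of the intersection graph along ring isomorphisms *)

Lemma preimage_left_ideal (R S : nzRingType) (f : {rmorphism R -> S}) (I : set S) :
  left_ideal I -> left_ideal (f @^-1` I).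
Proof.
move=> [I0 ID IM]; split=> [|x y|r x] /=; first by rewrite rmorph0.
  by rewrite rmorphD; apply: ID.
by rewrite rmorphM; apply: IM.
Qed.

Lemma preimage_rmorph0 (R S : nzRingType) (f : {rmorphism R -> S}) :
  injective f -> f @^-1` [set 0] = [set 0].
Proof.
move=> fI; apply/seteqP; split=> x /= => [fx|->]; last exact: rmorph0.
by apply: fI; rewrite fx rmorph0.
Qed.

Lemma preimage_nontrivial (R S : nzRingType) (f : {rmorphism R -> S}) (I : set S) :
  bijective f -> nontrivial_left_ideal I -> nontrivial_left_ideal (f @^-1` I).
Proof.
move=> [g fK gK] [Il I0 IT]; split; first exact: preimage_left_ideal.
  rewrite -(preimage_rmorph0 (can_inj fK)) => e; apply: I0; apply/funext => x.
  by move/(congr1 (@^~ (g x))): e; rewrite /preimage /= gK.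
move=> e; apply: IT; apply/funext => x.
by move/(congr1 (@^~ (g x))): e; rewrite /preimage /= gK.
Qed.

Lemma intersection_graph_iso (R S : nzRingType) : ring_isomorphic R S ->
  graph_iso (intersection_graph R) (intersection_graph S).
Proof.
move=> [f fb]; have [g fK gK] := fb.
have [g' gE] := rmorphism_of (can2_zmod_morphism fK gK) (can2_monoid_morphism fK gK).
have g'b : bijective g' by exists f => x; rewrite gE.
have fpre (I : set R) : f @^-1` (g' @^-1` I) = I.
  by apply/funext => x; rewrite /preimage /= gE fK.
have gpre (I : set S) : g' @^-1` (f @^-1` I) = I.
  by apply/funext => x; rewrite /preimage /= gE gK.
pose h (v : vertex (intersection_graph S)) := f @^-1` sval v.
have hI : injective h.
  move=> [I nI] [J nJ]; rewrite /h /= => /(congr1 (preimage g')); rewrite !gpre.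
  exact: eq_exist.
apply: (graph_iso_of_parametrization hI) => [I|v w].
  split=> [nI|[[J nJ] <-]]; last exact: preimage_nontrivial.
  by exists (exist _ _ (preimage_nontrivial g'b nI)); apply: fpre.
rewrite -preimage_setI -(preimage_rmorph0 (can_inj fK)) /= /ig_adj.
split=> -[vw vw0]; split=> // e; apply: vw0; last by rewrite e.
by rewrite -[LHS]gpre e gpre.
Qed.

(** * Lines through the origin of the left plane [D^2] over a division ring *)

Section Lines.
Variable D : nzRingType.
Hypothesis Ddiv : division_ring D.
Implicit Types V W : set (D * D).

Definition subspace V : Prop :=
  [/\ V 0, forall x y, V x -> V y -> V (x + y)
    & forall a x, V x -> V (a * x.1, a * x.2)].

(** [option D] is the projective line, with [None] the vertical direction; this accounts for the
    cardinal [|D| + 1]. Scalars act on the left, so the slope multiplies on the right. *)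
Definition line (o : option D) : set (D * D) :=
  if o is Some c then [set x | x.2 = x.1 * c] else [set x | x.1 = 0].

Definition line_point (o : option D) : D * D := if o is Some c then (1, c) else (0, 1).

Lemma line_subspace o : subspace (line o).
Proof.
case: o => [c|]; split; rewrite /= ?mul0r //.
- by move=> x y -> ->; rewrite mulrDl.
- by move=> a x ->; rewrite mulrA.
- by move=> x y -> ->; rewrite addr0.
- by move=> a x ->; rewrite mulr0.
Qed.

Lemma line_pointP o : line o (line_point o).
Proof. by case: o => [c|] //=; rewrite mul1r. Qed.

Lemma lineE o x : line o x -> exists a, x = (a * (line_point o).1, a * (line_point o).2).
Proof.
case: o x => [c|] [x y] /= ->; first by exists x; rewrite mulr1.
by exists y; rewrite mulr0 mulr1.
Qed.

Lemma line_point_neq0 o : line_point o <> 0.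
Proof. by case: o => [c|] e; [have := congr1 fst e|have := congr1 snd e] => /= /eqP;
  rewrite oner_eq0. Qed.

(** Normalized points tell the lines apart; injectivity, properness and trivial intersection of
    lines all come from this. *)
Lemma line_point_inj o o' : line o (line_point o') -> o = o'.
Proof.
case: o o' => [c|] [c'|] //=; first by rewrite mul1r => ->.
  by rewrite mul0r => /eqP; rewrite oner_eq0.
by move/eqP; rewrite oner_eq0.
Qed.

Lemma line_inj : injective line.
Proof. by move=> o o' e; apply: line_point_inj; rewrite e; apply: line_pointP. Qed.

Lemma line_neqT o : line o <> setT.
Proof.
move=> e; have h o' : o = o' by apply: line_point_inj; rewrite e.
by have := h None; rewrite (h (Some 0)).
Qed.

Lemma line_meet o o' x : o <> o' -> line o x -> line o' x -> x = 0.
Proof.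
move=> oo' /lineE [a ->] h; have [->|a0] := eqVneq a 0; first by rewrite !mul0r.
case: oo'; symmetry; apply: line_point_inj; have [b [ba _]] := Ddiv a0.
have [_ _ /(_ b _ h)] := line_subspace o'.
by rewrite /= !mulrA ba !mul1r -surjective_pairing.
Qed.

Lemma subspace_classification V : subspace V ->
  [\/ V = [set 0], V = setT | exists o, V = line o].
Proof.
move=> [V0 VD VM].
have lineV o : V (line_point o) -> line o `<=` V.
  by move=> Vo x /lineE [a ->]; apply: VM.
have allV c : V (1, c) -> V (0, 1) -> V = setT.
  move=> V1 V2; apply/seteqP; split=> // -[x y] _.
  have -> : (x, y) = (x * 1, x * c) + ((y - x * c) * 0, (y - x * c) * 1) :> D * D.
    by congr (_, _) => /=; rewrite ?mulr1 ?mulr0 ?addr0// addrC subrK.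
  by apply: VD; [exact: (VM x (1, c))|exact: (VM _ (0, 1))].
have norm x y z : V (x, y) -> z != 0 -> exists2 w, w * z = 1 & V (w * x, w * y).
  move=> Vxy z0; have [w [wz _]] := Ddiv z0; exists w => //.
  exact: (VM w (x, y)).
have [[x [y [Vxy x0]]]|nV] := pselect (exists x y, V (x, y) /\ x != 0).
  have [w wx V1] := norm _ _ _ Vxy x0; move: V1; rewrite wx; set c := w * y => V1.
  have [sV|/existsNP [[a b] /not_implyP [Vab /= bac]]] :=
      pselect (forall z, V z -> line (Some c) z).
    constructor 3; exists (Some c); apply/seteqP; split=> //.
    exact: (lineV (Some c)).
  constructor 2; apply: (allV c) => //.
  (* Subtracting [a (1, c)] from the vector [(a, b)] off the line leaves [(0, b - a c)], which is
     rescaled to [(0, 1)]. *)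
  have d0 : b - a * c != 0 by rewrite subr_eq0; apply/eqP.
  have Vd : V (0, b - a * c).
    have := VD _ _ Vab (VM (- a) _ V1); congr (V (_, _)) => /=.
      by rewrite mulr1 subrr.
    by rewrite mulNr.
  by have [v vd] := norm _ _ _ Vd d0; rewrite mulr0 vd.
have V1 z : V z -> z.1 = 0.
  by case: z => x y Vxy; apply: contrapT => /eqP x0; apply: nV; exists x, y.
have [[y [Vy y0]]|nV'] := pselect (exists y, V (0, y) /\ y != 0).
  have [v vy] := norm _ _ _ Vy y0; rewrite mulr0 vy => V01.
  by constructor 3; exists None; apply/seteqP; split=> //; apply: (lineV None).
constructor 1; apply/seteqP; split=> [[x y] Vxy|_ ->//].
have /= x0 := V1 _ Vxy; rewrite x0 in Vxy *; congr (_, _).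
by apply: contrapT => /eqP y0; apply: nV'; exists y.
Qed.

Lemma subspace_set0 : subspace [set 0].
Proof. by split=> //= [x y -> ->|a x ->]; rewrite ?addr0 //= mulr0. Qed.

End Lines.

(** * Left ideals of the matrix ring [M_2(D)] *)

Section MatrixRing.
Variable D : nzRingType.
Hypothesis Ddiv : division_ring D.
Implicit Types (V W : set (D * D)) (A : 'M[D]_2).

Definition row_pair A (i : 'I_2) : D * D := (A i 0, A i 1).
(** The Morita correspondence: left multiplication combines rows, so a left ideal is determined by
    the subspace of rows it allows. *)
Definition rows_in V : set 'M[D]_2 := [set A | forall i, V (row_pair A i)].
Definition top_row (x : D * D) : 'M[D]_2 :=
  \matrix_(i, j) if i == 0 then if j == 0 then x.1 else x.2 else 0.

Lemma row_pair_top x i : row_pair (top_row x) i = if i == 0 then x else 0.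
Proof. by rewrite /row_pair !mxE /=; case: (i == 0); case: x. Qed.

Lemma rows_in_top V x : V 0 -> rows_in V (top_row x) <-> V x.
Proof.
move=> V0; split=> [/(_ 0)|Vx i]; rewrite row_pair_top //.
by case: (i == 0).
Qed.

Lemma rows_in_left_ideal V : subspace V -> left_ideal (rows_in V).
Proof.
move=> [V0 VD VM]; split=> [i|A B VA VB i|A B VB i].
- by rewrite /row_pair !mxE.
- by rewrite /row_pair !mxE; apply: (VD _ _ (VA i) (VB i)).
- rewrite /row_pair !mxE !big_ord_recl !big_ord0 !addr0.
  exact: (VD _ _ (VM _ _ (VB _)) (VM _ _ (VB _))).
Qed.

Lemma rows_in_inj V W : subspace V -> subspace W -> rows_in V = rows_in W -> V = W.
Proof.
move=> [V0 _ _] [W0 _ _] VW; apply/funext => x; apply/propext.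
by rewrite -(rows_in_top x V0) VW rows_in_top.
Qed.

Lemma rows_in0 : rows_in [set 0] = [set 0].
Proof.
apply/seteqP; split=> [A A0|_ -> i]; last by rewrite /row_pair !mxE.
apply/matrixP => i j; rewrite mxE; have [Ai0 Ai1] := A0 i.
by case: j => [[|[|//]] lj]; [rewrite -[RHS]Ai0|rewrite -[RHS]Ai1];
  congr (A i _); apply: val_inj.
Qed.

Lemma rows_in_surj (I : set 'M[D]_2) : left_ideal I ->
  exists2 V, subspace V & I = rows_in V.
Proof.
move=> [I0 ID IM]; exists [set x | I (top_row x)].
  split=> /=.
  - suff -> : top_row 0 = 0 by [].
    by apply/matrixP => i j; rewrite !mxE; case: (i == 0); case: (j == 0).
  - move=> x y Ix Iy; suff -> : top_row (x + y) = top_row x + top_row y by apply: ID.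
    by apply/matrixP => i j; rewrite !mxE; case: (i == 0); case: (j == 0); rewrite ?addr0.
  - move=> a x Ix; suff -> : top_row (a * x.1, a * x.2) = a%:M * top_row x by apply: IM.
    rewrite -[RHS]/(a%:M *m top_row x) mul_scalar_mx.
    by apply/matrixP => i j; rewrite !mxE; case: (i == 0); case: (j == 0); rewrite ?mulr0.
apply/seteqP; split=> A.
  (* Multiplying by the matrix unit [delta_mx 0 i] moves row [i] to the top and clears the other
     row. *)
  move=> IA i; rewrite /= (_ : top_row _ = delta_mx 0 i * A); first exact: IM.
  apply/matrixP => k j; rewrite !mxE (bigD1 i) //= mxE eqxx andbT big1 => [|l li].
    rewrite addr0; case: ifP => k0; last by rewrite mul0r.
    by rewrite mul1r; case: j => [[|[|//]] lj]; congr (A i _); apply: val_inj.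
  by rewrite mxE (negPf li) andbF mul0r.
(* Conversely [A] is reassembled by moving each of its rows from the top back to its place. *)
move=> IA; have -> : A = \sum_i delta_mx i 0 * top_row (row_pair A i).
  apply/matrixP => k j; rewrite summxE (bigD1 k) //= big1 => [|i ik].
    rewrite addr0 mxE (bigD1 0) //= big1 => [|l l0].
      rewrite !mxE !eqxx mul1r addr0.
      by case: j => [[|[|//]] lj]; congr (A k _); apply: val_inj.
    by rewrite !mxE (negPf l0) andbF mul0r.
  by rewrite mxE big1 // => l _; rewrite !mxE eq_sym (negPf ik) mul0r.
by elim/big_ind: _ => // i _; apply/IM/IA.
Qed.

Lemma matrix_ring_graph :
  graph_iso (intersection_graph 'M[D]_2) (null_graph (option D)).
Proof.
apply: (@graph_iso_of_parametrization _ (null_graph (option D))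
          (fun o => rows_in (line o))) => [o o' /rows_in_inj e|I|o o'].
- exact/line_inj/e/line_subspace/line_subspace.
- split=> [[Il I0 IT]|[o <-]].
    have [V sV IV] := rows_in_surj Il.
    case: (subspace_classification Ddiv sV) => [V0|VT|[o Vo]].
    + by case: I0; rewrite IV V0 rows_in0.
    + by case: IT; rewrite IV VT; apply/seteqP.
    + by exists o; rewrite IV Vo.
  split; first exact/rows_in_left_ideal/line_subspace.
    rewrite -rows_in0 => /(rows_in_inj (line_subspace o) (subspace_set0 D)) l0.
    by apply: (@line_point_neq0 D o); have := line_pointP o; rewrite l0.
  move=> e; apply: (@line_neqT D o); apply: rows_in_inj => //.
    exact: line_subspace.
  by rewrite e; apply/seteqP.
- split=> // -[oo' []]; rewrite -rows_in0; apply/seteqP; split=> [A [Ao Ao'] i|A A0].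
    exact: (line_meet Ddiv oo' (Ao i) (Ao' i)).
  by split=> i; rewrite (A0 i); case: (line_subspace o); case: (line_subspace o').
Qed.

End MatrixRing.

(** * Graphs of sums of division rings and of types (i) and (iii) *)

Lemma division_sum_graph (D1 D2 : nzRingType) :
  division_ring D1 -> division_ring D2 ->
  graph_iso (intersection_graph (D1 * D2)%type) (null_graph 'I_2).
Proof.
move=> div1 div2; pose R : nzRingType := (D1 * D2)%type.
pose K (i : 'I_2) : set R := if i == 0 then [set x | x.2 = 0] else [set x | x.1 = 0].
have ne0 (D : nzRingType) : 1 <> 0 :> D by apply/eqP; rewrite oner_eq0.
have Kl i : left_ideal (K i).
  rewrite /K; case: ifP => _; split=> //= [x y -> ->|r x ->];
    by rewrite ?addr0 ?mulr0.
apply: (@graph_iso_of_parametrization R (null_graph 'I_2) K) => [i j|I|i j].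
- case: i j => [[|[|//]] li] [[|[|//]] lj] // e; try exact: val_inj.
    have : K (Ordinal li) (1, 0) by []. by rewrite e => /= /ne0.
  have : K (Ordinal lj) (1, 0) by []. by rewrite -e => /= /ne0.
- split=> [[Il I0 IT]|[i <-]].
    case: (Il) => _ ID IM.
    (* A nonzero coordinate can be inverted and the other one killed by a left multiplication, so
       [I] contains the whole factor. *)
    have Ifst x : I x -> x.1 != 0 -> forall a, I (a, 0).
      move=> Ix x0 a; have [y [yx _]] := div1 _ x0.
      have -> : (a, 0) = (a * y, 0) * x :> R.
        by congr (_, _) => /=; rewrite ?mul0r // -mulrA yx mulr1.
      exact: IM.
    have Isnd x : I x -> x.2 != 0 -> forall b, I (0, b).
      move=> Ix x0 b; have [y [yx _]] := div2 _ x0.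
      have -> : (0, b) = (0, b * y) * x :> R.
        by congr (_, _) => /=; rewrite ?mul0r // -mulrA yx mulr1.
      exact: IM.
    have Iadd a b : I (a, 0) -> I (0, b) -> I (a, b).
      move=> Ia Ib; have -> : (a, b) = (a, 0) + (0, b) :> R.
        by congr (_, _); rewrite /= ?addr0 ?add0r.
      exact: ID.
    have [[x [Ix x0]]|n1] := pselect (exists x, I x /\ x.1 != 0);
    have [[y [Iy y0]]|n2] := pselect (exists y, I y /\ y.2 != 0).
    + case: IT; apply/seteqP; split=> // -[a b] _.
      by apply: Iadd; [exact: Ifst x0 _|exact: Isnd y0 _].
    + exists 0; apply/seteqP; split=> [[a b] b0|z Iz].
        by rewrite (b0 : b = 0); exact: Ifst x0 _.
      by apply: contrapT => /eqP z0; apply: n2; exists z.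
    + exists 1; apply/seteqP; split=> [[a b] a0|z Iz].
        by rewrite (a0 : a = 0); exact: Isnd y0 _.
      by apply: contrapT => /eqP z0; apply: n1; exists z.
    + case: I0; apply/seteqP; split=> [[a b] Iab|_ ->]; last by case: Il.
      congr (_, _); apply: contrapT => /eqP z0; [apply: n1|apply: n2];
      by exists (a, b).
  split=> // e.
    case: i e => [[|[|//]] li] e.
      have : K (Ordinal li) (1, 0) by []. by rewrite e => /= /(congr1 fst) /ne0.
    have : K (Ordinal li) (0, 1) by []. by rewrite e => /= /(congr1 snd) /ne0.
  have : [set: R] 1 by []. by rewrite -e /K; case: ifP => _ /= /ne0.
- split=> // -[ij []]; apply/seteqP; split=> [x|_ ->]; last first.
    by case: (Kl i); case: (Kl j).
  case: i j ij => [[|[|//]] li] [[|[|//]] lj] ij; rewrite /K /= => -[];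
    do ?[by case: ij; apply: val_inj]; by case: x => a b /= -> ->.
Qed.

Lemma division_ring_graph (R : nzRingType) : division_ring R ->
  graph_iso (intersection_graph R) (null_graph 'I_0).
Proof.
(* The value [setT] is a dummy, as ['I_0] is empty. *)
move=> div; apply: (@graph_iso_of_parametrization _ (null_graph 'I_0) (fun=> setT)).
- by case.
- move=> I; split=> [[Il I0 IT]|[[]]//]; case: IT; apply: left_ideal1 => //.
  have [x Ix x0] := (left_ideal_neq0 Il).2 I0; have [y [<- _]] := div x x0.
  by case: Il => _ _; apply.
- by case.
Qed.

Lemma one_left_ideal_graph (R : nzRingType) : one_nontrivial_left_ideal R ->
  graph_iso (intersection_graph R) (complete_graph 'I_1).
Proof.
move=> one; apply: (@graph_iso_of_parametrization _ (complete_graph 'I_1)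
                      (fun=> prime_radical R)).
- by move=> i j _; rewrite !ord1.
- by move=> I; rewrite one; split=> [->|[]//]; exists 0.
- by move=> i j; rewrite !ord1; split=> [|[]].
Qed.

Lemma two_left_ideals_graph (R : nzRingType) : two_nontrivial_left_ideals R ->
  graph_iso (intersection_graph R) (complete_graph 'I_2).
Proof.
set b := prime_radical R => -[bb2 two].
have [bl b0 _] : nontrivial_left_ideal b by apply/two; left.
have [b2l b20 _] : nontrivial_left_ideal (ideal_mul b b) by apply/two; right.
have b2b : ideal_mul b b `<=` b.
  by apply: ideal_mul_sub => // x y _ by_; case: bl => _ _; apply.
pose g (i : 'I_2) := if i == 0 then b else ideal_mul b b.
have gI : injective g.
  case=> [[|[|//]] li] [[|[|//]] lj]; rewrite /g /= => e; try exact: val_inj.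
  by case: bb2.
apply: (@graph_iso_of_parametrization _ (complete_graph 'I_2) g gI) => [I|i j].
  rewrite two; split=> [[->|->]|[i <-]]; first by exists 0.
    by exists 1.
  by rewrite /g; case: ifP; [left|right].
split=> [ij|[]//]; split=> //; apply: (sub_neq0 b2l _ b20).
by rewrite /g; do 2!case: ifP => _; rewrite subsetI; split.
Qed.

(** The two isomorphisms combine to [psi], which identifies [D^2] with [beta(R)] and turns subspaces
    into left ideals. Besides the centre [None], standing for [beta(R)], the vertices are the lines,
    hence [option (option D)] for [|D| + 2]. *)
Lemma type_iii_graph (R D : nzRingType) : type_iii_over R D ->
  graph_iso (intersection_graph R) (@star_graph (option (option D)) None).
Proof.
move=> [Ddiv [pi [piT pib] [b2 [S1 [S2 [[bE S12] _ [iso1 iso2] _]]]]]].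
set b := prime_radical R in pib b2 bE.
case: iso1 => phi1 [phi1I phi1S phi1M]; case: iso2 => phi2 [phi2I phi2S phi2M].
pose psi (x : D * D) := phi1 x.1 + phi2 x.2.
have psiD x y : psi (x + y) = psi x + psi y by rewrite /psi !raddfD addrACA.
have psiM r x : psi (pi r * x.1, pi r * x.2) = r * psi x.
  by rewrite /psi /= phi1M phi2M mulrDr.
have psi0 : psi 0 = 0 by rewrite /psi !raddf0 addr0.
have psib : range psi = b.
  rewrite bE -phi1S -phi2S; apply/seteqP; split=> [_ [x _ <-]|].
    by exists (phi1 x.1), (phi2 x.2).
  by move=> _ [_ [_ [[x _ <-] [y _ <-] ->]]]; exists (x, y).
(* A relation [phi1 x.1 = - phi2 x.2] puts both sides in [S1 & S2], which is zero. *)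
have psi_eq0 x : psi x = 0 -> x = 0.
  move=> x0; have e : phi1 x.1 = phi2 (- x.2).
    by rewrite raddfN; apply/eqP; rewrite -addr_eq0; apply/eqP.
  have : (S1 `&` S2) (phi1 x.1).
    by split; [rewrite -phi1S; exists x.1|rewrite -phi2S e; exists (- x.2)].
  rewrite S12 => /= p1; move: (p1); rewrite e raddfN => /eqP; rewrite oppr_eq0 => /eqP p2.
  case: x {x0 e} p1 p2 => x y /= p1 p2; congr (_, _).
    by apply: phi1I; rewrite p1 raddf0.
  by apply: phi2I; rewrite p2 raddf0.
have psiI : injective psi.
  move=> x y e; apply/eqP; rewrite -subr_eq0; apply/eqP/psi_eq0.
  by apply: (addIr (psi y)); rewrite -psiD addrNK e add0r.
have bl : left_ideal b.
  split; first by rewrite -pib /= rmorph0.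
    by move=> x y; rewrite -pib /= rmorphD => -> ->; rewrite addr0.
  by move=> r x; rewrite -pib /= rmorphM => ->; rewrite mulr0.
have imgl V : subspace V -> left_ideal (psi @` V).
  move=> [V0 VD VM]; split; first by exists 0.
    by move=> _ _ [x Vx <-] [y Vy <-]; exists (x + y) => //; apply: VD.
  by move=> r _ [x Vx <-]; exists (pi r * x.1, pi r * x.2) => //; apply: VM.
have img_inj V W : psi @` V = psi @` W -> V = W.
  move=> VW; apply/seteqP; split=> x Vx.
    by have : (psi @` W) (psi x); [rewrite -VW; exists x|case=> y Wy /psiI <-].
  by have : (psi @` V) (psi x); [rewrite VW; exists x|case=> y Wy /psiI <-].
have img0 : psi @` [set 0] = [set 0] by rewrite image_set1 psi0.
have bmax I : left_ideal I -> I <> setT -> I `<=` b.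
  move=> Il IT r Ir; apply: contrapT; rewrite -pib /= => /eqP r0.
  apply: IT; apply: left_ideal1 => //.
  have [d [dr _]] := Ddiv _ r0.
  have [|s _ sd] := (_ : range pi d); first by rewrite piT.
  have bs : b (1 - s * r) by rewrite -pib /= rmorphB rmorph1 rmorphM sd dr subrr.
  have := ideal_mul_mem bs bs; rewrite b2 /= => c0.
  (* c = 1 - s r lies in beta, so c^2 = 0 and 1 + c is inverse to s r = 1 - c. *)
  have <- : (1 + (1 - s * r)) * s * r = 1.
    rewrite -mulrA -{2}[s * r](subKr 1) mulrBr mulr1 mulrDl mul1r c0 addr0.
    by rewrite addrK.
  by case: Il => _ _; apply.
have b1 : b <> setT.
  move=> e; have : b 1 by rewrite e.
  by rewrite -pib /= rmorph1 => /eqP; rewrite oner_eq0.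
have line_img o : psi @` line o <> [set 0].
  rewrite -img0 => /img_inj e; apply: (@line_point_neq0 D o).
  by have := line_pointP o; rewrite e.
have line_b o : psi @` line o `<=` b by rewrite -psib => _ [x _ <-]; exists x.
have line_neqb o : psi @` line o <> b.
  by rewrite -psib => /img_inj; apply: line_neqT.
pose g (v : option (option D)) := if v is Some o then psi @` line o else b.
have gb v : g v `<=` b by case: v => [o|] /=; [exact: line_b|].
have g0 v : g v <> [set 0].
  case: v => [o|] //=; apply: (sub_neq0 (imgl _ (line_subspace None)) _ (line_img _)).
  exact: line_b.
have gl v : left_ideal (g v) by case: v => [o|] //=; apply/imgl/line_subspace.
apply: (@graph_iso_of_parametrization _ (@star_graph _ None) g) => [|I|v w].
- case=> [o|] [o'|] //=; [by move=> /img_inj /line_inj ->|by move/line_neqb|].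
  by move/esym/line_neqb.
- split=> [[Il I0 IT]|[v <-]]; last by split=> //; apply: sub_neqT (gb v) b1.
  have Ib := bmax _ Il IT.
  pose V := psi @^-1` I; have IV : I = psi @` V.
    apply/seteqP; split=> [x Ix|_ [x Vx <-]//].
    by have := Ib _ Ix; rewrite -psib => -[y _ yx]; exists y => //; rewrite /V /= yx.
  have sV : subspace V.
    case: (Il) => I0' ID IM; split; rewrite /V /preimage /=; first by rewrite psi0.
      by move=> x y Vx Vy; rewrite psiD; apply: ID.
    (* Every scalar of [D] lifts to [R], where closure of [I] under left multiplication applies. *)
    move=> a x Vx; have [|r _ <-] := (_ : range pi a); first by rewrite piT.
    by rewrite psiM; apply: IM.
  case: (subspace_classification Ddiv sV) => [V0|VT|[o Vo]].
  + by case: I0; rewrite IV V0.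
  + by exists None; rewrite IV VT psib.
  + by exists (Some o); rewrite IV Vo.
- rewrite /=; split=> -[vw h]; split=> //.
    by case: h => ->; [rewrite setIidr|rewrite setIidl].
  case: v w vw h => [o|] [o'|] vw h; try by [left|right].
  case: h; apply/seteqP; split=> [_ [[x ox <-] [y oy /psiI yx]]|_ ->]; last first.
    by split; [case: (gl (Some o))|case: (gl (Some o'))].
  rewrite yx in oy; rewrite (@line_meet D Ddiv o o' x) //.
  by move=> e; apply: vw; rewrite e.
Qed.

Theorem theorem5p3 (R : nzRingType) :
  [/\ (* the equivalence of (1) and (2) *)
      triangle_free (intersection_graph R)
        <-> [\/ type_i R, type_ii R | type_iii R],
      (* the types are independent *)
      [/\ ~ (type_i R /\ type_ii R), ~ (type_i R /\ type_iii R)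
        & ~ (type_ii R /\ type_iii R)],
      (* graphs in type (i) *)
      [/\ division_ring R ->
            graph_iso (intersection_graph R) (null_graph 'I_0),
          one_nontrivial_left_ideal R ->
            graph_iso (intersection_graph R) (complete_graph 'I_1)
        & two_nontrivial_left_ideals R ->
            graph_iso (intersection_graph R) (complete_graph 'I_2)],
      (* graphs in type (ii) *)
      (forall D : nzRingType, is_matrix_ring_over R D ->
         graph_iso (intersection_graph R) (null_graph (option D))) /\
      (forall D1 D2 : nzRingType, is_sum_of_division_rings R D1 D2 ->
         graph_iso (intersection_graph R) (null_graph 'I_2))
    & (* graph in type (iii) *)
      forall D : nzRingType, type_iii_over R D ->
        graph_iso (intersection_graph R)
          (@star_graph (option (option D)) None)].
Proof.
have matrix D : is_matrix_ring_over R D ->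
    graph_iso (intersection_graph R) (null_graph (option D)).
  move=> [Ddiv /intersection_graph_iso RD].
  exact: graph_iso_trans RD (matrix_ring_graph Ddiv).
have sum D1 D2 : is_sum_of_division_rings R D1 D2 ->
    graph_iso (intersection_graph R) (null_graph 'I_2).
  move=> [div1 div2 /intersection_graph_iso RD].
  exact: graph_iso_trans RD (division_sum_graph div1 div2).
(* Independence is read off the graphs: type (i) gives complete graphs, type (ii) edgeless ones that
   are not complete, and type (iii) graphs that are neither. *)
have complete_i : type_i R ->
    complete (intersection_graph R) /\ triangle_free (intersection_graph R).
  case=> [/division_ring_graph|/one_left_ideal_graph|/two_left_ideals_graph] iso.
  - split; first by apply/(complete_iso iso) => -[].
    by apply/(triangle_free_iso iso)/edgeless_triangle_free => -[].
  - split; first exact/(complete_iso iso).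
    exact/(triangle_free_iso iso)/complete_triangle_free.
  - split; first exact/(complete_iso iso).
    exact/(triangle_free_iso iso)/complete_triangle_free.
have edgeless_ii : type_ii R ->
    edgeless (intersection_graph R) /\ ~ complete (intersection_graph R).
  case=> [[D /matrix iso]|[D1 [D2 /sum iso]]].
    split; first by apply/(edgeless_iso iso) => x y [].
    by move/(complete_iso iso) => /(_ None (Some 0)); apply.
  split; first by apply/(edgeless_iso iso) => x y [].
  by move/(complete_iso iso) => /(_ 0 1); apply.
have star_iii : type_iii R -> [/\ ~ complete (intersection_graph R),
    ~ edgeless (intersection_graph R) & triangle_free (intersection_graph R)].
  move=> [D /type_iii_graph iso]; split.
  (* Two leaves of the star are not adjacent, whereas its centre and a leaf are. *)
  - move/(complete_iso iso) => /(_ (Some None) (Some (Some 0))) /=.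
    by case=> [|_ []].
  - move/(edgeless_iso iso) => /(_ None (Some None)) /=; apply.
    by split=> //; left.
  - exact/(triangle_free_iso iso)/star_triangle_free.
split; last exact: type_iii_graph.
- split=> [|[/complete_i[]|/edgeless_ii[e _]|/star_iii[]]] //.
    exact: triangle_free_types.
  exact: edgeless_triangle_free.
- split=> -[].
  + by move=> /complete_i[h _] /edgeless_ii[].
  + by move=> /complete_i[h _] /star_iii[].
  + by move=> /edgeless_ii[h _] /star_iii[].
- split; [exact: division_ring_graph|exact: one_left_ideal_graph|].
  exact: two_left_ideals_graph.
- by split.
Qed.
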